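(* Let $\lambda=(\lambda_1,\lambda_2,\dots,\lambda_\ell>0,0^{n-\ell})$ be a partition of length $\ell\le n$ such that $\lambda_1=\lambda_2=\cdots=\lambda_k$ for some $1\le k\le\ell$. Let $\mathbf{x}=(x_1,\dots,x_n)$ and $\mathbf{t}=(t_1,\dots,t_{\ell-1})$ be commuting indeterminates, and define $x_{n+j}:=t_j$ for $j=1,\dots,k-1$. Then $$g_\lambda(\mathbf{x};\mathbf{t})=\sum_{S=\{j_1<j_2<\cdots<j_\ell\}\in\binom{[n+k-1]}{\ell}}\ \prod_{i\in\overline{S}}\prod_{j\in S}\frac{x_j}{x_j-x_i}\ \, g_\lambda\bigl(x_{j_1},\dots,x_{j_{\ell-k+1}};\,x_{j_{\ell-k+2}},\dots,x_{j_\ell},t_k,\dots,t_{\ell-1}\bigr).$$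
   Context: $\binom{[N]}{\ell}$ is the set of $\ell$-element subsets of $[N]=\{1,\dots,N\}$, and for $S\in\binom{[n+k-1]}{\ell}$, $\overline{S}=\{1,\dots,n+k-1\}\setminus S$. A reverse plane partition of shape $\lambda$ (English convention, row 1 at the top) is a filling of the boxes of $\lambda$ with positive integers that weakly increases along rows and down columns. Let $\mathrm{RPP}^N(\lambda)$ be the set of those with all entries at most $N$. For $T\in\mathrm{RPP}^N(\lambda)$, let $a_i$ be the number of columns of $T$ containing $i$, and let $b_r$ be the number of boxes in row $r$ whose entry equals the entry in the box directly below. For sequences $\mathbf{z}=(z_1,\dots,z_N)$ (any $N$) and $\mathbf{u}=(u_1,\dots,u_{\ell-1})$, the refined dual Grothendieck polynomial is $g_\lambda(\mathbf{z};\mathbf{u}):=\sum_{T\in\mathrm{RPP}^N(\lambda)}\prod_{r}u_r^{b_r}\prod_{i}z_i^{a_i}$. On the right-hand side of the identity the first argument has $\ell-k+1$ entries and the second has $(k-1)+(\ell-k)=\ell-1$ entries. The identity is one of rational functions. *)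

(* Defs.v *)
From HB Require Import structures.
From mathcomp Require Import all_boot all_algebra.

Set Implicit Arguments.
Unset Strict Implicit.
Unset Printing Implicit Defensive.

Import GRing.Theory.
Local Open Scope ring_scope.

(* All indices are 0-based: rows, columns, variables, and the entries of a
   filling, where i : 'I_N stands for the positive integer i + 1 <= N. *)

(* A partition is given by its nonzero parts, so its length is its size. *)
Definition is_partition (lam : seq nat) : bool :=
  sorted geq lam && all (leq 1) lam.

Definition box (lam : seq nat) : finType :=
  {r : 'I_(size lam) & 'I_(nth 0%N lam r)}.

Definition brow (lam : seq nat) (b : box lam) : nat := tag b.
Definition bcol (lam : seq nat) (b : box lam) : nat := tagged b.

Definition is_rpp (lam : seq nat) (N : nat) (T : {ffun box lam -> 'I_N}) :
    bool :=
  [forall b, forall b',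
     ((brow b == brow b') && (bcol b <= bcol b')%N ==> (T b <= T b')%N)
  && ((bcol b == bcol b') && (brow b <= brow b')%N ==> (T b <= T b')%N)].

(* The columns of the diagram are indexed by 'I_(lam_1). *)
Definition rpp_a (lam : seq nat) (N : nat) (T : {ffun box lam -> 'I_N})
    (i : 'I_N) : nat :=
  #|[set c : 'I_(nth 0%N lam 0) | [exists b, (bcol b == c) && (T b == i)]]|.

Definition rpp_b (lam : seq nat) (N : nat) (T : {ffun box lam -> 'I_N})
    (r : nat) : nat :=
  #|[set b : box lam | (brow b == r) &&
       [exists b', [&& brow b' == r.+1, bcol b' == bcol b & T b' == T b]]]|.

Definition dual_groth (A : comNzRingType) (lam : seq nat) (z u : seq A) : A :=
  \sum_(T : {ffun box lam -> 'I_(size z)} | is_rpp T)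
    (\prod_(r < size u) u`_r ^+ rpp_b T r) *
    (\prod_(i < size z) z`_i ^+ rpp_a T i).

(* Main.v *)
(* A reverse plane partition is weighted box by box: a box equal to the one below
   it contributes u_row, any other box contributes z_entry.  Removing the boxes
   with the largest entry gives a branching rule from lam to mu whose weight is a
   product over the rows.  Write row_i(a) = (h_{a - j})_j in the variables z and
   u_0, ..., u_{i-1}.  In the determinant of the rows row_i(lam_i + l - 1 - i),
   adding the last z expands each row, modulo the next one, by the same row
   weights; the terms that do not come from partitions cancel, because summing
   row_p(a) over a <= b with the branching weights gives a multiple of
   row_{p+1}(b).  Hence g_lam is this Jacobi-Trudi determinant.

   When lam_0 = ... = lam_{k-1}, row operations put u_0, ..., u_{k-2} into all the
   first k rows, so the determinant only involves the union X of z and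
   u_0, ..., u_{k-2}, apart from the later u's.  By Lagrange interpolation
     h_m(X + t) = sum_{v in X} v^(#|X| - 1 - d) h_{m + d}(v + t) / prod_{w != v} (v - w),
   so the matrix is a product P Q with Q carrying all the dependence on X outside
   of v; Cauchy-Binet over the l-subsets S of X, compared with the same
   factorization for X = S, gives the sum over S. *)
Require Import Defs.
From HB Require Import structures.
From mathcomp Require Import all_boot all_order all_algebra.
From mathcomp Require Import mpoly.
From mathcomp Require Import ring zify.
Import GRing.Theory.
Local Open Scope ring_scope.

Set Implicit Arguments.
Unset Strict Implicit.
Unset Printing Implicit Defensive.

(** * Complete homogeneous symmetric polynomials of a list *)

Fixpoint hsym (A : comNzRingType) (s : seq A) : nat -> A :=
  match s with
  | [::] => fun d => (d == 0)%:R
  | x :: s' => fix aux d :=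
      match d with 0 => 1 | d'.+1 => hsym s' d'.+1 + x * aux d' end
  end.

(* The zero branch is the convention h_m = 0 for m < 0. *)
Definition hshift (A : comNzRingType) (s : seq A) (a j : nat) : A :=
  if (j <= a)%N then hsym s (a - j) else 0.

Section HSym.
Variable A : comNzRingType.
Implicit Types (s : seq A) (x y : A).

Lemma hsym0 s : hsym s 0 = 1. Proof. by case: s. Qed.

Lemma hsymS x s d : hsym (x :: s) d.+1 = hsym s d.+1 + x * hsym (x :: s) d.
Proof. by []. Qed.

Lemma hsym_swap x y s : hsym [:: x, y & s] =1 hsym [:: y, x & s].
Proof.
(* Two consecutive degrees are carried because unfolding degree [d.+2] uses the symmetry in degrees
   [d] and [d.+1]. *)
suff H d : hsym [:: x, y & s] d = hsym [:: y, x & s] d /\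
           hsym [:: x, y & s] d.+1 = hsym [:: y, x & s] d.+1.
  by move=> d; case: (H d).
elim: d => [|d [IH0 IH1]]; first by rewrite !hsymS !hsym0; split=> //; ring.
split=> //; rewrite 2!hsymS [RHS]hsymS [hsym (x :: s) _]hsymS.
have /eqP := IH1; rewrite hsymS [X in _ == X]hsymS -subr_eq0 => /eqP E.
rewrite !(hsymS _ (_ :: _)) IH0.
have -> : hsym (x :: s) d.+1 = hsym (y :: s) d.+1 + x * hsym [:: x, y & s] d
   - y * hsym [:: y, x & s] d by apply/eqP; rewrite -subr_eq0 -oppr_eq0 -E; apply/eqP; ring.
by rewrite IH0; ring.
Qed.

Lemma eq_hsym_cons x s1 s2 : hsym s1 =1 hsym s2 ->
  hsym (x :: s1) =1 hsym (x :: s2).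
Proof. by move=> E; elim=> [|d IH] //; rewrite !hsymS E IH. Qed.

Lemma hsym_move x s1 s2 : hsym (s1 ++ x :: s2) =1 hsym (x :: s1 ++ s2).
Proof.
elim: s1 => [|y s1 IH] // d.
by rewrite cat_cons (eq_hsym_cons y IH) hsym_swap.
Qed.

Lemma perm_hsym s1 s2 : perm_eq s1 s2 -> hsym s1 =1 hsym s2.
Proof.
elim: s1 s2 => [|x s1 IH] s2; first by rewrite perm_sym => /perm_nilP ->.
move=> E; have := mem_head x s1; rewrite (perm_mem E) => /path.splitPr E2.
case: E2 E => p1 p2; rewrite perm_sym perm_catC cat_cons perm_cons => E d.
rewrite hsym_move; apply: eq_hsym_cons; apply: IH.
by rewrite perm_sym perm_catC.
Qed.

Lemma perm_hshift s1 s2 : perm_eq s1 s2 -> hshift s1 =2 hshift s2.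
Proof. by move=> E a j; rewrite /hshift (perm_hsym E). Qed.

Lemma hshift0 s j : hshift s 0 j = (j == 0)%:R.
Proof. by rewrite /hshift leqn0; case: eqP => // ->; rewrite subnn hsym0. Qed.

Lemma hshiftS x s a j :
  hshift (x :: s) a.+1 j = hshift s a.+1 j + x * hshift (x :: s) a j.
Proof.
rewrite /hshift; case: (leqP j a) => [ja|aj]; first by rewrite leqW // subSn.
rewrite mulr0 addr0; case: ifP => // ja.
have -> : (a.+1 - j = 0)%N by lia.
by rewrite !hsym0.
Qed.

Lemma hshift_nil a j : hshift ([::] : seq A) a j = (a == j)%:R.
Proof.
rewrite /hshift; case: (leqP j a) => [ja|aj]; last by rewrite ltn_eqF.
by rewrite /= subn_eq0 [RHS]/= eqn_leq ja andbT.
Qed.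

Lemma hshift_geom x s b j :
  \sum_(a < b.+1) x ^+ (b - a) * hshift s a j = hshift (x :: s) b j.
Proof.
elim: b => [|b IH]; first by rewrite big_ord1 subnn mul1r !hshift0.
rewrite hshiftS -IH big_ord_recr /= subnn mul1r addrC big_distrr /=.
by congr (_ + _); apply: eq_bigr => i _; rewrite subSn ?exprS ?mulrA // -ltnS.
Qed.

(** Expand h over [x], [y], [s] once by splitting off [y] and once by splitting off [x], and
    compare. *)
Lemma hshift_exch x y s a j :
  hshift (y :: s) a.+1 j - hshift (x :: s) a.+1 j =
  (y - x) * hshift [:: y, x & s] a j.
Proof.
have E : perm_eq [:: y, x & s] [:: x, y & s].
  by apply/seq.permP=> p /=; lia.
have := hshiftS y (x :: s) a j; rewrite (perm_hshift E a.+1) hshiftS.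
rewrite -(perm_hshift E a) => E2.
have -> : hshift (y :: s) a.+1 j = hshift (x :: s) a.+1 j +
    y * hshift [:: y, x & s] a j - x * hshift [:: y, x & s] a j by rewrite -E2; ring.
by ring.
Qed.

End HSym.

(** * Determinant identities: row operations, multilinearity, Cauchy-Binet *)

Section Det.
Variable A : comNzRingType.

(** [M] is [C *m N] with [C] upper unitriangular. In the last row [insub] fails and nothing is
    added. *)
Lemma det_add_next_row l (M N : 'M[A]_l) (c : 'I_l -> A) :
  (forall i j, M i j = N i j +
     c i * (if insub i.+1 is Some i' then N i' j else 0)) ->
  \det M = \det N.
Proof.
move=> E; pose C : 'M[A]_l :=
  \matrix_(i, j) ((i == j)%:R + (if j == i.+1 :> nat then c i else 0)).
suff -> : M = C *m N.
  rewrite det_mulmx -(det_tr C) det_trig ?big1 ?mul1r // => [i _|].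
    by rewrite !mxE eqxx ltn_eqF // addr0.
  apply/is_trig_mxP => i j ij; rewrite !mxE -val_eqE gtn_eqF // add0r.
  by rewrite ltn_eqF // leqW.
apply/matrixP => i j; rewrite E mxE.
under eq_bigr => k _ do rewrite mxE mulrDl.
rewrite big_split /=; congr (_ + _).
  rewrite (bigD1 i) //= eqxx mul1r big1 ?addr0 // => k /negPf.
  by rewrite eq_sym => ->; rewrite mul0r.
case: insubP => [i' lt e|nlt].
  rewrite (bigD1 i') //= e eqxx big1 ?addr0 // => k /negPf.
  by rewrite -val_eqE /= e => ->; rewrite mul0r.
rewrite mulr0 big1 // => k _; rewrite ltn_eqF ?mul0r //.
by rewrite (leq_trans (ltn_ord k)) // leqNgt.
Qed.

Lemma det_sum_rows l m (V : 'I_l -> 'I_m -> 'I_l -> A) :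
  \det (\matrix_(i, j) \sum_(a < m) V i a j) =
  \sum_(f : {ffun 'I_l -> 'I_m}) \det (\matrix_(i, j) V i (f i) j).
Proof.
rewrite exchange_big; apply: eq_bigr => /= s _; rewrite -big_distrr /=.
congr (_ * _).
under eq_bigr => i _ do rewrite mxE.
by rewrite bigA_distr_bigA; apply: eq_bigr => f _; apply: eq_bigr => i _; rewrite mxE.
Qed.

Lemma det_scale_rows l (c : 'I_l -> A) (M : 'M[A]_l) :
  \det (\matrix_(i, j) (c i * M i j)) = (\prod_i c i) * \det M.
Proof.
rewrite big_distrr /=; apply: eq_bigr => s _; rewrite mulrCA; congr (_ * _).
by rewrite -big_split; apply: eq_bigr => i _; rewrite mxE.
Qed.

(** Non-injective [f] repeat a row and vanish. The injections with image [S] are not collected into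
    a minor of [P], so that two expansions with the same [P] can be compared term by term. *)
Lemma Cauchy_Binet l m (P : 'M[A]_(l, m)) (Q : 'M[A]_(m, l)) :
  \det (P *m Q) =
  \sum_(S : {set 'I_m} | #|S| == l)
    \sum_(f : {ffun 'I_l -> 'I_m} | injectiveb f && (f @: setT == S))
      (\prod_i P i (f i)) * \det (rowsub f Q).
Proof.
transitivity (\sum_(f : {ffun 'I_l -> 'I_m}) (\prod_i P i (f i)) * \det (rowsub f Q)).
  have -> : P *m Q = \matrix_(i, j) \sum_(a < m) (P i a * Q a j).
    by apply/matrixP => i j; rewrite !mxE.
  rewrite det_sum_rows; apply: eq_bigr => f _; rewrite -det_scale_rows.
  by congr (\det _); apply/matrixP => i j; rewrite !mxE.
rewrite (bigID (fun f : {ffun _} => injectiveb f)) /= addrC big1 ?add0r; last first.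
  move=> f /injectivePn [i1 [i2 d12 e]].
  by rewrite (determinant_alternate d12) ?mulr0 // => j; rewrite !mxE e.
rewrite (partition_big (fun f : {ffun _} => f @: setT) (fun S => #|S| == l)) //.
by move=> f /injectiveP inj; rewrite card_imset // cardsT card_ord.
Qed.

End Det.

(** * Row weights for removing the largest letter *)

Section Step.
Variable A : comNzRingType.

(** Weight of the boxes removed when a shifted row length drops from [L] to [a]. Positions before
    [D] have a box underneath, which then also carries the largest letter. *)
Definition stepw (u z : A) (D L a : nat) : A :=
  \prod_(a <= c < L) (if (c < D)%N then u else z).

(** Up to [b <= D] every step weighs [u], so the sum is geometric and adjoins [u] to the
    alphabet. *)
Lemma stepw_prefix u z s D L b j : (b <= D)%N -> (b <= L)%N ->
  \sum_(a < b.+1) stepw u z D L a * hshift s a j =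
  stepw u z D L b * hshift (u :: s) b j.
Proof.
move=> bD bL; rewrite -hshift_geom big_distrr; apply: eq_bigr => /= a _.
rewrite mulrA; congr (_ * _); have ab : (a <= b)%N by rewrite -ltnS.
rewrite /stepw (big_cat_nat ab bL) /= mulrC; congr (_ * _).
rewrite -prodr_const_nat [LHS]big_nat [RHS]big_nat; apply: eq_bigr => c /andP[_ cb].
by rewrite (leq_trans cb).
Qed.

(** At [L = D] the sum is h over [u :: s], which [hshift_exch] turns into h over [z :: s] plus a
    correction. Each step past [D] multiplies by [z], as in [hshiftS]. *)
Lemma stepw_row_sum u z s D L j : (D <= L)%N ->
  \sum_(a < L.+1) stepw u z D L a * hshift s a j =
  hshift (z :: s) L j +
    z ^+ (L - D) * (u - z) * (if D is D'.+1 then hshift [:: u, z & s] D' j else 0).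
Proof.
elim: L => [|L IH] DL.
  have -> : D = 0%N by lia.
  by rewrite big_ord1 /stepw big_geq // mul1r !hshift0 mulr0 addr0.
move: DL; rewrite leq_eqVlt => /predU1P [->|DL].
  rewrite stepw_prefix // /stepw big_geq // mul1r subnn mul1r -hshift_exch.
  by rewrite addrC subrK.
rewrite big_ord_recr /= {2}/stepw big_geq // mul1r hshiftS.
have -> : \sum_(a < L.+1) stepw u z D L.+1 a * hshift s a j =
          z * \sum_(a < L.+1) stepw u z D L a * hshift s a j.
  rewrite big_distrr; apply: eq_bigr => /= a _.
  have aL : (a <= L)%N by rewrite -ltnS.
  by rewrite /stepw big_nat_recr //= ltnNge -ltnS DL /= mulrAC mulrA mulrC mulrA.
by rewrite IH // subSn // exprS mulrDr !mulrA [LHS]addrC addrA.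
Qed.

Lemma sum_ord_widen m b (F : nat -> A) : (b < m)%N ->
  \sum_(a < m | (a <= b)%N) F a = \sum_(a < b.+1) F a.
Proof.
by move=> bm; rewrite (big_ord_widen m F bm); apply: eq_bigl => a; rewrite ltnS.
Qed.

End Step.

(** * Adding one variable to the determinant *)

Section Branching.
Variables (A : comNzRingType) (l m : nat) (s : nat -> seq A) (u : nat -> A) (z : A).
Variables (L D : nat -> nat).
Hypothesis s_cons : forall i, s i.+1 = u i :: s i.
Hypothesis D_next : forall i, (i.+1 < l)%N -> D i = (L i.+1).+1.
Hypothesis D_last : forall i, (i.+1 = l)%N -> D i = 0.
Hypothesis D_le : forall i, (i < l)%N -> (D i <= L i)%N.
Hypothesis L_lt : forall i, (i < l)%N -> (L i < m)%N.

(** Interpolates between all row choices bounded by [L] ([p = l]) and the strictly decreasing ones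
    ([p = 0]), which encode partitions. *)
Definition decr_from p (a : {ffun 'I_l -> 'I_m}) : bool :=
  [forall i, (a i <= L i)%N] &&
  [forall i : 'I_l, forall i' : 'I_l, (p <= i)%N && (i' == i.+1 :> nat) ==> (a i' < a i)%N].

Let row_term (a : {ffun 'I_l -> 'I_m}) : A :=
  (\prod_(i < l) stepw (u i) z (D i) (L i) (a i)) *
  \det (\matrix_(i < l, j < l) hshift (s i) (a i) (l - j.+1)).

Definition upd (a : {ffun 'I_l -> 'I_m}) (p : 'I_l) (x : 'I_m) :=
  [ffun i => if i == p then x else a i].

(** Laplace expansion along row [p] isolates the dependence on [x]; the cofactors do not see it. *)
Lemma row_term_upd a p x : row_term (upd a p x) =
  (\prod_(i < l | i != p) stepw (u i) z (D i) (L i) (a i)) *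
  \sum_(j < l) (stepw (u p) z (D p) (L p) x * hshift (s p) x (l - j.+1)) *
      cofactor (\matrix_(i < l, j < l) hshift (s i) (a i) (l - j.+1)) p j.
Proof.
rewrite /row_term (bigD1 p) //= ffunE eqxx (expand_det_row _ p).
rewrite [stepw _ _ _ _ _ * _]mulrC -mulrA; congr (_ * _).
  by apply: eq_bigr => i /negPf ip; rewrite ffunE ip.
rewrite big_distrr; apply: eq_bigr => /= j _; rewrite mulrA mxE ffunE eqxx.
congr (_ * _); rewrite /cofactor; congr (_ * \det _); apply/matrixP => i i'.
by rewrite !mxE ffunE eq_sym (negPf (neq_lift _ _)).
Qed.

(** By [stepw_prefix] the sum makes row [p] a multiple of h over [u p :: s p] at [b p']. Since
    [s p.+1 = u p :: s p], this is row [p']. *)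
Lemma nondecr_cancel (p p' : 'I_l) (b : {ffun 'I_l -> 'I_m}) :
  p' = p.+1 :> nat -> (b p' <= L p')%N ->
  \sum_(x < m | (x <= b p')%N) row_term (upd b p x) = 0.
Proof.
move=> pp' bL; have lt : (p.+1 < l)%N by rewrite -pp'.
have bD : (b p' < D p)%N by rewrite D_next // ltnS -pp'.
under eq_bigr => x _ do rewrite row_term_upd.
rewrite -big_distrr exchange_big /=.
suff -> : \sum_(j < l) \sum_(x < m | (x <= b p')%N)
    (stepw (u p) z (D p) (L p) x * hshift (s p) x (l - j.+1)) *
      cofactor (\matrix_(i < l, j < l) hshift (s i) (b i) (l - j.+1)) p j = 0.
  by rewrite mulr0.
set C := \matrix_(i < l, j < l) _.
transitivity (stepw (u p) z (D p) (L p) (b p') *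
  \det (\matrix_(i, j) C (if i == p then p' else i) j)).
  rewrite (expand_det_row _ p) big_distrr /=; apply: eq_bigr => j _.
  rewrite -big_distrl /= mxE eqxx [RHS]mulrA; congr (_ * _).
    rewrite (sum_ord_widen
      (fun x => stepw (u p) z (D p) (L p) x * hshift (s p) x (l - j.+1))) //.
    rewrite stepw_prefix ?(ltnW bD) // ?mxE ?pp' ?s_cons //.
    by rewrite (leq_trans (ltnW bD)) ?D_le.
  rewrite /cofactor; congr (_ * \det _); apply/matrixP => i i'.
  by rewrite !mxE eq_sym (negPf (neq_lift _ _)).
have pp : p != p' by rewrite -val_eqE /= pp' ltn_eqF.
rewrite (determinant_alternate pp) ?mulr0 // => j.
by rewrite !mxE eqxx eq_sym (negPf pp).
Qed.

Lemma decr_from_step p : (p <= l)%N ->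
  \sum_(a | decr_from p a) row_term a = \sum_(a | decr_from p.+1 a) row_term a.
Proof.
move=> pl; case: (ltnP p.+1 l) => [lt|ge]; last first.
  apply: eq_bigl => a; congr (_ && _); apply: eq_forallb => i.
  apply: eq_forallb => i'; case: eqP => [e|]; last by rewrite !andbF.
  by have := ltn_ord i'; case: (leqP p i) => pi; rewrite ?andbT //=;
    case: (leqP p.+1 i) => //; lia.
have lt' := ltnW lt; pose q := Ordinal lt'; pose q' := Ordinal lt.
rewrite [RHS](bigID (fun a : {ffun 'I_l -> 'I_m} => (a q' < a q)%N)) /=.
rewrite [X in _ + X](_ : _ = 0) ?addr0.
  apply: eq_bigl => a; rewrite /decr_from -andbA; congr (_ && _).
  apply/forallP/andP => [H|[/forallP H aq] i].
    split; last by move/forallP/(_ q')/implyP: (H q); apply; rewrite /= leqnn eqxx.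
    apply/forallP => i; apply/forallP => i'; apply/implyP => /andP[pi e].
    by move/forallP/(_ i')/implyP: (H i); apply; rewrite (ltnW pi) e.
  apply/forallP => i'; apply/implyP => /andP[pi e].
  move: pi; rewrite leq_eqVlt => /predU1P [pi|pi].
    have -> : i = q by apply: val_inj; rewrite /= pi.
    by have -> // : i' = q' by apply: val_inj; rewrite /= (eqP e) -pi.
  by move/forallP/(_ i')/implyP: (H i); apply; rewrite pi e.
have m0 : (0 < m)%N by apply: leq_ltn_trans (leq0n _) (L_lt lt).
pose x0 := Ordinal m0.
(* The unwanted terms, with [a q <= a q'], are grouped by their values off [q]; resetting the value
   at [q] to the placeholder [x0] records the group. Each group is a full range as in
   [nondecr_cancel]. *)
rewrite (partition_big (fun a => upd a q x0)
  (fun b => decr_from p.+1 b && (b q == x0))) /=.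
  rewrite big1 // => b /andP[Hb /eqP bq].
  have bL : (b q' <= L q')%N by case/andP: Hb => /forallP/(_ q').
  have qq : q' != q by rewrite -val_eqE /= gtn_eqF.
  rewrite -[RHS](@nondecr_cancel q q' b) //.
  rewrite (reindex_onto (fun x => upd b q x) (fun a => a q)) /=; last first.
    move=> a /andP[_ /eqP <-]; apply/ffunP => i; rewrite !ffunE.
    by case: eqP => // ->.
  apply: eq_bigl => x; rewrite !ffunE !eqxx (negPf qq) !andbT -leqNgt.
  have -> : upd (upd b q x) q x0 = b.
    by apply/ffunP => i; rewrite !ffunE; case: eqP => // ->.
  rewrite eqxx andbT andbC; case: (leqP x (b q')) => //= xb.
  case/andP: Hb => /forallP HL /forallP H; apply/andP; split.
    (* The bound at [q] is automatic: [x <= b q' <= L q' < D q <= L q]. *)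
    apply/forallP => i; rewrite ffunE; case: eqP => // ->.
    apply: leq_trans xb _; apply: leq_trans bL _.
    by have := D_le lt'; rewrite D_next //= => /ltnW.
  apply/forallP => i; apply/forallP => i'; apply/implyP => /andP[pi e].
  have iq : (i == q) = false by apply/eqP => E; move: pi; rewrite E /= ltnn.
  have iq' : (i' == q) = false by apply/eqP => E; move: pi (eqP e); rewrite E /=; lia.
  rewrite !ffunE iq iq'.
  by move/forallP/(_ i')/implyP: (H i); apply; rewrite pi e.
move=> a /andP[/andP[/forallP HL /forallP H] _]; rewrite ffunE eqxx eqxx andbT.
apply/andP; split; first by apply/forallP => i; rewrite ffunE; case: eqP => //=.
apply/forallP => i; apply/forallP => i'; apply/implyP => /andP[pi e].
have iq : (i == q) = false by apply/eqP => E; move: pi; rewrite E /= ltnn.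
have iq' : (i' == q) = false by apply/eqP => E; move: pi (eqP e); rewrite E /=; lia.
rewrite !ffunE iq iq'.
by move/forallP/(_ i')/implyP: (H i); apply; rewrite pi e.
Qed.

(** Summing each row over all [a i <= L i] changes it only by a multiple of the next row. After
    multilinear expansion, [decr_from_step] discards the choices that are not strictly
    decreasing. *)
Lemma hshift_det_branch :
  \det (\matrix_(i < l, j < l) hshift (z :: s i) (L i) (l - j.+1)) =
  \sum_(a | decr_from 0 a)
    (\prod_(i < l) stepw (u i) z (D i) (L i) (a i)) *
    \det (\matrix_(i < l, j < l) hshift (s i) (a i) (l - j.+1)).
Proof.
have -> : \sum_(a | decr_from 0 a) row_term a = \sum_(a | decr_from l a) row_term a.
  suff H p : (p <= l)%N -> \sum_(a | decr_from 0 a) row_term a =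
      \sum_(a | decr_from p a) row_term a.
    exact: H.
  by elim: p => // p IH pl; rewrite (IH (ltnW pl)) [LHS]decr_from_step // ltnW.
transitivity (\det (\matrix_(i < l, j < l) \sum_(a < m) if (a <= L i)%N then
    stepw (u i) z (D i) (L i) a * hshift (s i) a (l - j.+1) else 0)).
  (* The multiplier comes from [stepw_row_sum]: its correction is h over [u i], [z], [s i] at
     [D i - 1 = L i.+1], which is row [i.+1]. *)
  symmetry; apply: (det_add_next_row (c := fun i => z ^+ (L i - D i) * (u i - z))).
  move=> i j; rewrite !mxE -big_mkcond /=.
  rewrite (sum_ord_widen
    (fun x => stepw (u i) z (D i) (L i) x * hshift (s i) x (l - j.+1))) ?L_lt //.
  rewrite stepw_row_sum ?D_le //; congr (_ + _ * _); case: insubP => [i' lt e|nlt].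
    have e' : i' = i.+1 :> nat := e.
    rewrite mxE e' D_next -?e' //= e' s_cons; apply: perm_hshift.
    by apply/seq.permP => P /=; lia.
  by rewrite D_last //; have := ltn_ord i; lia.
rewrite det_sum_rows [RHS]big_mkcond; apply: eq_bigr => a _.
case: ifP => [/andP[/forallP HL _]|/negbT].
  rewrite /row_term -det_scale_rows; congr (\det _); apply/matrixP => i j.
  by rewrite !mxE HL.
rewrite negb_and => /orP[/forallPn[i ni]|/forallPn[i /forallPn[i']]]; last first.
  by rewrite (leqNgt l i) ltn_ord.
rewrite (expand_det_row _ i) big1 // => j _; rewrite mxE (negPf ni) mul0r //.
Qed.

End Branching.

(** * Fillings read as functions on all positions *)

Section Entries.
Variables (lam : seq nat).
Hypothesis lam_sorted : sorted geq lam.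

Lemma part_nth_le r r' : (r <= r')%N -> (nth 0%N lam r' <= nth 0%N lam r)%N.
Proof.
move=> rr'; case: (ltnP r' (size lam)) => [lt|ge]; last by rewrite nth_default.
have geq_trans : transitive geq by move=> x y z xy yz; apply: leq_trans yz xy.
by apply: (sorted_leq_nth geq_trans leqnn 0%N lam_sorted); rewrite ?inE ?(leq_ltn_trans rr').
Qed.

Lemma bcol_lt (b : box lam) : (bcol b < nth 0%N lam (brow b))%N.
Proof. by case: b => r c /=; exact: ltn_ord. Qed.

Lemma box_inj (b b' : box lam) : brow b = brow b' -> bcol b = bcol b' -> b = b'.
Proof.
case: b b' => [r c] [r' c'] /val_inj /= e; rewrite -e in c' *.
by move/val_inj => /= ->.
Qed.

Lemma box_ex r c : (c < nth 0%N lam r)%N ->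
  exists2 b : box lam, brow b = r & bcol b = c.
Proof.
move=> lt; have rl : (r < size lam)%N.
  by rewrite ltnNge; apply/negP => ge; rewrite nth_default in lt.
by exists (Tagged (fun r : 'I_(size lam) => 'I_(nth 0%N lam r))
  (Ordinal lt : 'I_(nth 0%N lam (Ordinal rl)))).
Qed.

Section Entry.
Variable N : nat.
Implicit Type T : {ffun box lam -> 'I_N}.

(* Boxes outside the shape read as N, an entry larger than all those of T. *)
Definition entry T (r c : nat) : nat :=
  if [pick b | (brow b == r) && (bcol b == c)] is Some b then T b else N.

Lemma entryE T b : entry T (brow b) (bcol b) = T b.
Proof.
rewrite /entry; case: pickP => [b' /andP[/eqP er /eqP ec]|/(_ b)].
  by rewrite (box_inj er ec).
by rewrite !eqxx.
Qed.

Lemma entry_lt T r c : (entry T r c < N)%N = (c < nth 0%N lam r)%N.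
Proof.
case: (ltnP c (nth 0%N lam r)) => [/box_ex[b <- <-]|ge]; first by rewrite entryE ltn_ord.
rewrite /entry; case: pickP => [b /andP[/eqP er /eqP ec]|_]; last by rewrite ltnn.
by have := bcol_lt b; rewrite er ec ltnNge ge.
Qed.

Lemma entry_le T r c : (entry T r c <= N)%N.
Proof. by rewrite /entry; case: pickP => // b _; exact: ltnW. Qed.

Lemma entry_out T r c : (nth 0%N lam r <= c)%N -> entry T r c = N.
Proof.
by move=> ge; apply/eqP; rewrite eqn_leq entry_le leqNgt entry_lt -leqNgt.
Qed.

Lemma entry_inj T T' : entry T =2 entry T' -> T = T'.
Proof. by move=> e; apply/ffunP => b; apply: val_inj; rewrite /= -!entryE e. Qed.

(** Going down the column and then along the row stays in the shape; reading [N] outside removes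
    every shape condition from the inequality. *)
Lemma is_rppP T : reflect
  (forall r r' c c', (r <= r')%N -> (c <= c')%N -> (entry T r c <= entry T r' c')%N)
  (is_rpp T).
Proof.
apply: (iffP forallP) => [H r r' c c' rr' cc'|H b]; last first.
  by apply/forallP => b'; rewrite -!entryE; apply/andP; split;
     apply/implyP => /andP[/eqP -> le]; apply: H.
case: (ltnP c' (nth 0%N lam r')) => [lt|ge]; last by rewrite (entry_out T ge) entry_le.
have lt1 : (c < nth 0%N lam r')%N by apply: leq_ltn_trans cc' lt.
have lt2 : (c < nth 0%N lam r)%N by apply: leq_trans lt1 (part_nth_le rr').
case: (box_ex lt) (box_ex lt1) (box_ex lt2) => [b2 er2 ec2] [b1 er1 ec1] [b er ec].
rewrite -{1}er -{1}ec -er2 -ec2 !entryE; apply: (@leq_trans (T b1)).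
  by have /forallP/(_ b1)/andP[_ /implyP] := H b; apply; rewrite ec ec1 er er1 eqxx.
by have /forallP/(_ b2)/andP[/implyP + _] := H b1; apply; rewrite ec2 ec1 er2 er1 eqxx.
Qed.

End Entry.

Lemma prod_box (A : comNzRingType) (F : nat -> nat -> A) :
  \prod_(b : box lam) F (brow b) (bcol b) =
  \prod_(r < size lam) \prod_(c < nth 0%N lam r) F r c.
Proof. by rewrite sig_big_dep. Qed.

End Entries.

(** * Box weights and restriction to a smaller shape *)

Section Weights.
Variables (A : comNzRingType) (u z : nat -> A).

(** A box with nothing below it always gets [z]: [entry] reads [N] there, which no entry of [T]
    equals. *)
Definition rpp_weight lam N (T : {ffun box lam -> 'I_N}) : A :=
  \prod_(r < size lam) \prod_(c < nth 0%N lam r)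
    (if entry T r.+1 c == entry T r c then u r else z (entry T r c)).

Definition rpp_sum N lam : A :=
  \sum_(T : {ffun box lam -> 'I_N} | is_rpp T) rpp_weight T.

Definition sub_shape lam N mu (T : {ffun box lam -> 'I_N.+1}) : bool :=
  [forall b, (T b < N)%N == (bcol b < nth 0%N mu (brow b))%N].

Section Restrict.
Variables (lam mu : seq nat) (N : nat).
Hypotheses (lam_sorted : sorted geq lam) (mu_sorted : sorted geq mu).
Hypotheses (mu_size : size mu = size lam).
Hypothesis mu_le : forall r, (nth 0%N mu r <= nth 0%N lam r)%N.

(** Outside [mu] the default [N] of [entry] is exactly the largest letter of ['I_N.+1], so no case
    split is needed. *)
Definition extend_rpp (T : {ffun box mu -> 'I_N}) : {ffun box lam -> 'I_N.+1} :=
  [ffun b => inord (entry T (brow b) (bcol b))].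

Lemma extend_rppE T r c : entry (extend_rpp T) r c =
  if (c < nth 0%N lam r)%N then entry T r c else N.+1.
Proof.
case: ltnP => [lt|ge]; last by rewrite entry_out.
by case: (box_ex lt) => b <- <-; rewrite entryE ffunE inordK // ltnS entry_le.
Qed.

Lemma extend_rpp_inj : injective extend_rpp.
Proof.
move=> T T' e; apply: entry_inj => r c.
have := extend_rppE T r c; rewrite e extend_rppE; case: ltnP => // ge _.
by rewrite !entry_out // (leq_trans (mu_le r)).
Qed.

Lemma extend_rpp_image :
  [set T : {ffun box lam -> 'I_N.+1} | is_rpp T && sub_shape mu T] =
  extend_rpp @: [set T | is_rpp T].
Proof.
apply/setP => T; rewrite inE; apply/andP/imsetP => [[rT /forallP sT]|[T' + ->]].
  have lt (b : box mu) : (entry T (brow b) (bcol b) < N)%N.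
    have := leq_trans (bcol_lt b) (mu_le _) => /box_ex [b' er ec].
    by rewrite -er -ec entryE (eqP (sT b')) er ec bcol_lt.
  pose T' := [ffun b : box mu => Ordinal (lt b)].
  (* Truncation at [N] is monotone, so [T'] inherits the inequalities of [T]. *)
  have T'E r c : entry T' r c = minn N (entry T r c).
    case: (ltnP c (nth 0%N mu r)) => [/box_ex[b <- <-]|ge].
      by rewrite entryE ffunE /= (minn_idPr _) // ltnW // lt.
    rewrite (entry_out _ ge); apply/esym/minn_idPl.
    case: (ltnP c (nth 0%N lam r)) => [/box_ex[b er ec]|ge']; last by rewrite entry_out.
    by rewrite -er -ec entryE leqNgt (eqP (sT b)) -leqNgt er ec.
  exists T'.
    rewrite inE; apply/is_rppP => // r r' c c' rr' cc'; rewrite !T'E.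
    by move/is_rppP: rT => /(_ lam_sorted r r' c c' rr' cc'); lia.
  apply: entry_inj => r c; rewrite extend_rppE T'E.
  case: ltnP => [/box_ex[b er ec]|ge]; last by rewrite entry_out.
  by apply/esym/minn_idPr; rewrite -er -ec entryE -ltnS ltn_ord.
rewrite inE => /(is_rppP mu_sorted) rT'; split.
  apply/is_rppP => // r r' c c' rr' cc'; rewrite !extend_rppE.
  case: (ltnP c' _) => lt; last by case: ifP => // _; rewrite leqW // entry_le.
  rewrite (leq_trans (leq_ltn_trans cc' lt)) ?part_nth_le //.
  exact: rT'.
by apply/forallP => b; rewrite ffunE inordK ?entry_lt // ltnS entry_le.
Qed.

(** Below a removed box lies either another removed box, with equal entry, or nothing, because [mu]
    is weakly decreasing. A box of [mu] keeps its weight, since a removed box below it is strictly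
    larger. *)
Lemma extend_rpp_weight T : is_rpp T ->
  rpp_weight (extend_rpp T) =
  (\prod_(r < size lam) \prod_(nth 0%N mu r <= c < nth 0%N lam r)
      (if (c < nth 0%N lam r.+1)%N then u r else z N)) * rpp_weight T.
Proof.
move=> rT; rewrite /rpp_weight mu_size -big_split; apply: eq_bigr => /= r _.
rewrite -(big_mkord xpredT
  (fun c => if entry (extend_rpp T) r.+1 c == entry (extend_rpp T) r c
     then u r else z (entry (extend_rpp T) r c))).
rewrite (big_cat_nat (leq0n _) (mu_le r)) /= big_mkord mulrC; congr (_ * _).
  rewrite [LHS]big_nat [RHS]big_nat; apply: eq_bigr => c /andP[ge lt].
  rewrite !extend_rppE lt (entry_out T ge) //; case: ltnP => lt'; last by rewrite gtn_eqF.
  by rewrite entry_out ?eqxx // (leq_trans _ ge) ?part_nth_le.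
apply: eq_bigr => c _; rewrite !extend_rppE.
rewrite (leq_trans (ltn_ord c) (mu_le r)); case: (ltnP c (nth 0%N lam r.+1)) => // ge.
have lt : (entry T r c < N)%N by rewrite entry_lt.
rewrite (entry_out T (leq_trans (mu_le _) ge)) gtn_eqF; last by rewrite leqW.
by rewrite gtn_eqF.
Qed.

Lemma sum_sub_shape :
  \sum_(T : {ffun box lam -> 'I_N.+1} | is_rpp T && sub_shape mu T) rpp_weight T =
  (\prod_(r < size lam) \prod_(nth 0%N mu r <= c < nth 0%N lam r)
      (if (c < nth 0%N lam r.+1)%N then u r else z N)) * rpp_sum N mu.
Proof.
transitivity (\sum_(T in extend_rpp @: [set T | is_rpp T]) rpp_weight T).
  by apply: eq_bigl => T; rewrite -extend_rpp_image inE.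
rewrite big_imset /=; last by move=> T T' _ _; apply: extend_rpp_inj.
rewrite big_distrr; apply: eq_big => [T|T]; rewrite inE //.
exact: extend_rpp_weight.
Qed.

End Restrict.
End Weights.

Lemma count_iota_initial (p : pred nat) k c : {homo p : x y / (y <= x)%N >-> x -> y} ->
  (c < k)%N -> (c < count p (iota 0 k))%N = p c.
Proof.
move=> pd ck; have -> : k = (c + (k - c).-1.+1)%N by lia.
rewrite iotaD count_cat /= add0n; case pc: (p c).
  have /eqP -> : count p (iota 0 c) == size (iota 0 c).
    by rewrite -all_count; apply/allP => x; rewrite mem_iota => /andP[_ /ltnW xc]; exact: pd pc.
  by rewrite size_iota; lia.
have /eqP -> : count p (iota c.+1 (k - c).-1) == 0%N.
  rewrite -leqn0 leqNgt -has_count; apply/hasPn => x; rewrite mem_iota => /andP[/ltnW cx _].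
  by apply/negP => px; have := pd _ _ cx px; rewrite pc.
by have := count_size p (iota 0 c); rewrite size_iota; lia.
Qed.

(** * Branching rule for the weighted sum and the Jacobi-Trudi determinant *)

Section Recursion.
Variables (A : comNzRingType) (u z : nat -> A).

(* a stands for mu + (l - 1, ..., 1, 0); decr_from L 0 a makes the truncated
   subtraction harmless. *)
Definition mu_of l m (a : {ffun 'I_l -> 'I_m}) : seq nat :=
  [seq (a i - (l - i.+1))%N | i <- enum 'I_l].

Lemma size_mu_of l m (a : {ffun 'I_l -> 'I_m}) : size (mu_of a) = l.
Proof. by rewrite size_map size_enum_ord. Qed.

Lemma nth_mu_of l m (a : {ffun 'I_l -> 'I_m}) (i : 'I_l) :
  nth 0%N (mu_of a) i = (a i - (l - i.+1))%N.
Proof. by rewrite (nth_map i) ?size_enum_ord // nth_ord_enum. Qed.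

Section Shapes.
Variables (lam : seq nat) (l m : nat).
Hypotheses (lam_size : size lam = l) (lam_sorted : sorted geq lam).
Let L i := (nth 0%N lam i + (l - i.+1))%N.
Hypothesis L_lt : forall i, (i < l)%N -> (L i < m)%N.
Implicit Type a : {ffun 'I_l -> 'I_m}.

Lemma decr_ge a (i : 'I_l) : decr_from L 0 a -> (l - i.+1 <= a i)%N.
Proof.
case/andP => _ /forallP H; move: {2}(l - i.+1)%N (erefl (l - i.+1)%N) => d.
elim: d i => [|d IH] i e; first by rewrite e.
have lt : (i.+1 < l)%N by lia.
have e' : (l - (Ordinal lt).+1)%N = d by rewrite /=; lia.
have := IH (Ordinal lt) e'; move/forallP/(_ (Ordinal lt)): (H i); rewrite /= eqxx /=.
by rewrite e; move: e' => /= ->; lia.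
Qed.

Lemma decr_mu_of a (i : 'I_l) : decr_from L 0 a ->
  (nth 0%N (mu_of a) i + (l - i.+1))%N = a i.
Proof. by move=> da; rewrite nth_mu_of subnK ?decr_ge. Qed.

Lemma mu_of_sorted a : decr_from L 0 a -> sorted geq (mu_of a).
Proof.
move=> da; apply/(sortedP 0%N) => i; rewrite size_mu_of => lt.
have [i0 i1] : (i < l)%N /\ (i.+1 < l)%N by lia.
have := decr_mu_of (Ordinal i0) da; have := decr_mu_of (Ordinal i1) da.
case/andP: da => _ /forallP/(_ (Ordinal i0))/forallP/(_ (Ordinal i1)).
by rewrite /= eqxx /=; lia.
Qed.

Lemma mu_of_le a r : decr_from L 0 a -> (nth 0%N (mu_of a) r <= nth 0%N lam r)%N.
Proof.
move=> da; case: (ltnP r l) => [lt|ge]; last by rewrite nth_default // size_mu_of.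
rewrite (nth_mu_of a (Ordinal lt)) leq_subLR addnC.
by case/andP: da => /forallP/(_ (Ordinal lt)).
Qed.

Lemma sub_shapeP a N (T : {ffun box lam -> 'I_N.+1}) r c : decr_from L 0 a ->
  sub_shape (mu_of a) T -> (entry T r c < N)%N = (c < nth 0%N (mu_of a) r)%N.
Proof.
move=> da /forallP sT; case: (ltnP c (nth 0%N lam r)) => [/box_ex[b <- <-]|ge].
  by rewrite entryE (eqP (sT b)).
rewrite entry_out // ltnNge leqnSn /=; apply/esym/negbTE; rewrite -leqNgt.
exact: leq_trans (mu_of_le _ da) ge.
Qed.

(** In each row the entries less than [N] form an initial segment, so their number [M r] is forced
    as the row length of [mu]. *)
Lemma sub_shape_uniq N (T : {ffun box lam -> 'I_N.+1}) : is_rpp T ->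
  exists a0, (fun a => decr_from L 0 a && sub_shape (mu_of a) T) =1 pred1 a0.
Proof.
move/(is_rppP lam_sorted) => rT.
pose M r := count (fun c => (entry T r c < N)%N) (iota 0 (nth 0%N lam r)).
have ML r : (M r <= nth 0%N lam r)%N.
  by rewrite -[X in (_ <= X)%N](size_iota 0) count_size.
have ME r c : (c < M r)%N = (entry T r c < N)%N.
  case: (ltnP c (nth 0%N lam r)) => [lt|ge].
    apply: count_iota_initial lt => x y yx; apply: leq_ltn_trans; exact: rT.
  by rewrite entry_out // ltnNge (leq_trans (ML r) ge) ltnNge leqnSn.
have lt (i : 'I_l) : (M i + (l - i.+1) < m)%N.
  by apply: leq_ltn_trans (L_lt (ltn_ord i)); rewrite leq_add2r.
pose a0 : {ffun 'I_l -> 'I_m} := [ffun i => Ordinal (lt i)].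
have da0 : decr_from L 0 a0.
  apply/andP; split; first by apply/forallP => i; rewrite ffunE /= leq_add2r.
  apply/forallP => i; apply/forallP => i'; apply/implyP => /andP[_ /eqP e].
  (* Position [M i] of row [i] already reads at least [N], hence so does the position below it. *)
  rewrite !ffunE /= e; have M_le : (M i.+1 <= M i)%N.
    rewrite leqNgt ME -leqNgt; have : (M i < M i)%N = false by rewrite ltnn.
    by rewrite ME => /negbT; rewrite -leqNgt => /leq_trans; apply; apply: rT.
  by have := ltn_ord i'; rewrite e; lia.
have nth_a0 (r : 'I_l) : nth 0%N (mu_of a0) r = M r by rewrite nth_mu_of ffunE /= addnK.
have sa0 : sub_shape (mu_of a0) T.
  apply/forallP => b; have bl : (brow b < l)%N by rewrite -lam_size; exact: ltn_ord.
  by rewrite (nth_a0 (Ordinal bl)) ME entryE.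
exists a0 => a; apply/andP/eqP => [[da sa]|-> //].
apply/ffunP => i; apply: val_inj; rewrite /= -(decr_mu_of i da) -(decr_mu_of i da0).
have key c : (c < nth 0%N (mu_of a) i)%N = (c < nth 0%N (mu_of a0) i)%N.
  by rewrite -(sub_shapeP i c da sa) (sub_shapeP i c da0 sa0).
congr (_ + _)%N; apply/eqP; rewrite eqn_leq; apply/andP.
by split; rewrite leqNgt; [rewrite key|rewrite -key]; rewrite ltnn.
Qed.

Lemma rpp_sum_rec N : rpp_sum u z N.+1 lam =
  \sum_(a : {ffun 'I_l -> 'I_m} | decr_from L 0 a)
    (\prod_(i < l) stepw (u i) (z N) (nth 0%N lam i.+1 + (l - i.+1)) (L i) (a i)) *
    rpp_sum u z N (mu_of a).
Proof.
transitivity (\sum_(a : {ffun 'I_l -> 'I_m} | decr_from L 0 a)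
   \sum_(T : {ffun box lam -> 'I_N.+1} | is_rpp T && sub_shape (mu_of a) T) rpp_weight u z T).
  rewrite (exchange_big_dep (@is_rpp lam N.+1)) /=; last by move=> a T _ /andP[].
  apply: eq_bigr => T rT; have [a0 H] := sub_shape_uniq rT.
  by rewrite (big_pred1 a0) // => a; rewrite rT -H.
apply: eq_bigr => a da.
rewrite sum_sub_shape ?mu_of_sorted ?size_mu_of //; last by move=> r; exact: mu_of_le.
congr (_ * _); rewrite lam_size; apply: eq_bigr => i _.
(* Shifting the columns of row [i] by [l - i.+1] matches the box product with [stepw]. *)
rewrite /stepw -(decr_mu_of i da) /L [RHS]big_addn addnK.
by apply: eq_bigr => c _; rewrite ltn_add2r.
Qed.

End Shapes.

(** If all parts are zero there is one filling and the matrix is unitriangular. Otherwise there is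
    no filling, and row 0 vanishes: its alphabet is empty and its degrees [lam_0 + j] are
    positive. *)
Lemma rpp_sum0 lam l : size lam = l -> sorted geq lam ->
  rpp_sum u z 0 lam = \det (\matrix_(i < l, j < l)
    hshift (rev (mkseq u i)) (nth 0%N lam i + (l - i.+1)) (l - j.+1)).
Proof.
move=> sz st; case: (posnP (nth 0%N lam 0)) => [lam0|lam_pos].
  have lamE i : nth 0%N lam i = 0%N by apply/eqP; rewrite -leqn0 -[X in (_ <= X)%N]lam0 part_nth_le.
  have nobox (b : box lam) : False by have := bcol_lt b; rewrite lamE.
  have T0 : {ffun box lam -> 'I_0} by exact: [ffun b => False_rect _ (nobox b)].
  rewrite /rpp_sum (big_pred1 T0); last first.
    move=> T; transitivity true; [|symmetry].
      by apply/forallP => b; case: (nobox b).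
    by apply/eqP/ffunP => b; case: (nobox b).
  rewrite /rpp_weight big1; last by move=> r _; rewrite big1 // => c;
    have := ltn_ord c; rewrite {2}lamE.
  rewrite -det_tr det_trig.
    by rewrite big1 // => i _; rewrite !mxE lamE /hshift leqnn subnn hsym0.
  apply/is_trig_mxP => i j ij; rewrite !mxE lamE /hshift ifF //.
  by apply/negbTE; rewrite -ltnNge; have := ltn_ord j; lia.
have l0 : (0 < l)%N by rewrite -sz; case: (lam) lam_pos.
have [b _ _] := box_ex lam_pos.
rewrite /rpp_sum big1; last by move=> T; case: (T b).
rewrite (expand_det_row _ (Ordinal l0)) big1 // => j _.
by rewrite mxE hshift_nil gtn_eqF ?mul0r //=; have := ltn_ord j; lia.
Qed.

(** Induction on [N], matching [rpp_sum_rec] with [hshift_det_branch]. Zero parts are allowed, so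
    every [mu] keeps [l] rows. *)
Lemma rpp_sum_det N lam l : size lam = l -> sorted geq lam ->
  rpp_sum u z N lam = \det (\matrix_(i < l, j < l)
    hshift (mkseq z N ++ mkseq u i) (nth 0%N lam i + (l - i.+1)) (l - j.+1)).
Proof.
move=> sz st.
(* Reversed alphabets give [s i.+1 = u i :: s i] literally. *)
transitivity (\det (\matrix_(i < l, j < l)
    hshift (rev (mkseq u i) ++ rev (mkseq z N)) (nth 0%N lam i + (l - i.+1)) (l - j.+1))); last first.
  congr (\det _); apply/matrixP => i j; rewrite !mxE; apply: perm_hshift.
  by rewrite perm_catC perm_cat // perm_rev.
elim: N lam sz st => [|N IH] lam sz st.
  by rewrite (rpp_sum0 sz st); congr (\det _); apply/matrixP => i j; rewrite !mxE cats0.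
pose L i := (nth 0%N lam i + (l - i.+1))%N; pose D i := (nth 0%N lam i.+1 + (l - i.+1))%N.
pose s i := rev (mkseq u i) ++ rev (mkseq z N).
have L_lt i : (i < l)%N -> (L i < nth 0%N lam 0 + l)%N.
  by move=> lt; have := part_nth_le st (leq0n i); rewrite /L; lia.
rewrite (rpp_sum_rec sz st L_lt).
transitivity (\det (\matrix_(i < l, j < l) hshift (z N :: s i) (L i) (l - j.+1))).
  rewrite (@hshift_det_branch _ _ (nth 0%N lam 0 + l) s u (z N) L D) //.
  - apply: eq_bigr => a da; congr (_ * _); rewrite IH ?size_mu_of //; last exact: mu_of_sorted da.
    by congr (\det _); apply/matrixP => i j; rewrite !mxE (decr_mu_of sz st i da).
  - by move=> i; rewrite /s mkseqS rev_rcons.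
  - by move=> i lt; rewrite /D /L; lia.
  - by move=> i e; rewrite /D nth_default ?sz ?e //; lia.
  - by move=> i lt; rewrite /D /L leq_add2r part_nth_le.
congr (\det _); apply/matrixP => i j; rewrite !mxE; apply: perm_hshift.
by apply/seq.permP => p; rewrite /s mkseqS rev_rcons /= !count_cat /=; lia.
Qed.

End Recursion.

(** * From row and column statistics to box weights *)

(** Each column containing [i] has exactly one box with entry [i] that is not repeated below, namely
    the lowest; so [rpp_a] counts boxes. *)
Lemma dual_groth_rpp_sum (A : comNzRingType) (lam : seq nat) (z u : seq A) :
  sorted geq lam -> (size lam <= (size u).+1)%N ->
  dual_groth lam z u = rpp_sum (nth 0 u) (nth 0 z) (size z) lam.
Proof.
move=> st su; apply: eq_bigr => T rT; set N := size z in T rT *.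
pose below (b : box lam) :=
  [exists b', [&& brow b' == (brow b).+1, bcol b' == bcol b & T b' == T b]].
have belowE b : below b = (entry T (brow b).+1 (bcol b) == entry T (brow b) (bcol b)).
  rewrite entryE; apply/existsP/eqP => [[b' /and3P[/eqP er /eqP ec /eqP <-]]|e].
    by rewrite -er -ec entryE.
  have : (bcol b < nth 0%N lam (brow b).+1)%N by rewrite -(entry_lt T) e ltn_ord.
  case/box_ex => b' er ec; exists b'; rewrite er ec !eqxx -val_eqE /= -entryE er ec e.
  exact: eqxx.
have -> : rpp_weight (nth 0 u) (nth 0 z) T =
    \prod_(b : box lam) if below b then nth 0 u (brow b) else nth 0 z (T b).
  rewrite /rpp_weight -(prod_box lam (fun r c => if entry T r.+1 c == entry T r c
     then nth 0 u r else nth 0 z (entry T r c))).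
  by apply: eq_bigr => b _; rewrite -belowE entryE.
rewrite (bigID below) /=; congr (_ * _).
  transitivity (\prod_(r < size u) \prod_(b | below b && (brow b == r)) nth 0 u r).
    apply: eq_bigr => r _; rewrite prodr_const; congr (_ ^+ _).
    rewrite /rpp_b; apply: eq_card => b; rewrite !inE unfold_in andbC.
    by case: eqP => [<-|]; rewrite ?andbF // !andbT.
  rewrite (exchange_big_dep below) /=; last by move=> r b _ /andP[].
  apply: eq_bigr => b bb; rewrite bb.
  have lt : (brow b < size u)%N.
    have /existsP[b' /andP[/eqP er _]] := bb.
    have : (brow b' < size lam)%N by exact: ltn_ord.
    by rewrite er => /leq_trans/(_ su).
  by rewrite (big_pred1 (Ordinal lt)) // => r; rewrite /= eq_sym -val_eqE.
transitivity (\prod_(i < N) \prod_(b | ~~ below b && (T b == i)) nth 0 z i).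
  apply: eq_bigr => i _; rewrite prodr_const; congr (_ ^+ _).
  have le0 (b : box lam) : (bcol b < nth 0%N lam 0)%N.
    exact: leq_trans (bcol_lt b) (part_nth_le st (leq0n _)).
  pose col b : 'I_(nth 0%N lam 0) := Ordinal (le0 b).
  have -> : rpp_a T i = #|col @: [set b | ~~ below b && (T b == i)]|.
    apply: eq_card => c; rewrite inE; apply/existsP/imsetP => [[b bP]|[b]]; last first.
      by rewrite inE => /andP[_ Tb] ->; exists b; rewrite Tb eqxx.
    case: (@arg_maxnP _ b (fun b => (bcol b == c) && (T b == i)) (@brow lam) bP).
    move=> b0 /andP[/eqP ec Tb] bmax; exists b0; last by apply: val_inj.
    rewrite inE Tb andbT; apply/existsP => -[b' /and3P[/eqP er ec' /eqP Tb']].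
    by have := bmax b'; rewrite (eqP ec') ec eqxx Tb' Tb /geq /= er ltnn => /(_ isT).
  rewrite card_in_imset => [|b b']; first by apply: eq_card => b; rewrite inE.
  wlog le : b b' / (brow b <= brow b')%N => [H|].
    case/orP: (leq_total (brow b) (brow b')) => le bP bP' e; first exact: H.
    by apply/esym/H.
  rewrite !inE => /andP[nb /eqP Tb] /andP[_ /eqP Tb'] /(congr1 val) /= ec.
  apply: (box_inj _ ec); apply/eqP; rewrite eqn_leq le leqNgt; apply/negP => lt.
  (* The box just below [b] is squeezed between the equal entries of [b] and [b']. *)
  case/negP: nb; rewrite belowE eqn_leq; apply/andP; split; last first.
    by move/(is_rppP st): rT; apply.
  apply: (@leq_trans (entry T (brow b') (bcol b))).
    by move/(is_rppP st): rT; apply.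
  by rewrite ec entryE Tb' -Tb -ec entryE.
rewrite (exchange_big_dep (fun b => ~~ below b)) /=; last by move=> r b _ /andP[].
by apply: eq_bigr => b bb; rewrite (negPf bb) /= (big_pred1 (T b)) // => i; rewrite eq_sym.
Qed.

(** * Row operations for equal leading parts *)

(** Among the equal parts the shifted lengths drop by exactly one per row. By [hshiftS], removing
    one letter from the alphabet then subtracts that letter times the next row; induction on [k]
    treats one letter at a time. *)
Lemma hshift_det_alphabet (A : comNzRingType) (l k : nat) (lam : seq nat) (z u : seq A) :
  (k < l)%N -> (k <= size u)%N ->
  (forall i, (i <= k)%N -> nth 0%N lam i = nth 0%N lam 0) ->
  \det (\matrix_(i < l, j < l)
     hshift (z ++ take i u) (nth 0%N lam i + (l - i.+1)) (l - j.+1)) =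
  \det (\matrix_(i < l, j < l)
     hshift (z ++ take (maxn i k) u) (nth 0%N lam i + (l - i.+1)) (l - j.+1)).
Proof.
move=> + + lamE; elim: k lamE => [|k IH] lamE kl ku.
  by congr (\det _); apply/matrixP => i j; rewrite !mxE maxn0.
rewrite IH ?(ltnW kl) ?(ltnW ku) //; last by move=> i ik; apply: lamE; apply: leqW.
apply: (det_add_next_row (c := fun i => if (i <= k)%N then - nth 0 u k else 0)) => i j.
rewrite !mxE; case: (leqP i k) => ik; last first.
  by rewrite mul0r addr0; congr (hshift (_ ++ take _ _) _ _); lia.
have lt : (i.+1 < l)%N by lia.
rewrite (insubT (fun x => x < l)%N lt) mxE /=.
have -> : maxn i k.+1 = k.+1 by lia.
have -> : maxn i.+1 k.+1 = k.+1 by lia.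
rewrite !lamE ?(leqW ik) //.
have -> : (nth 0%N lam 0 + (l - i.+1) = (nth 0%N lam 0 + (l - i.+2)).+1)%N by lia.
have P : perm_eq (z ++ take k.+1 u) (nth 0 u k :: z ++ take k u).
  by rewrite (take_nth 0) // -cats1 catA perm_catC.
by rewrite !(perm_hshift P) hshiftS mulNr addrK.
Qed.

Lemma dual_groth_det (A : comNzRingType) (l k : nat) (lam : seq nat) (z u : seq A) :
  size lam = l -> sorted geq lam -> (k < l)%N -> (l <= (size u).+1)%N ->
  (forall i, (i <= k)%N -> nth 0%N lam i = nth 0%N lam 0) ->
  dual_groth lam z u =
  \det (\matrix_(i < l, j < l)
     hshift (z ++ take (maxn i k) u) (nth 0%N lam i + (l - i.+1)) (l - j.+1)).
Proof.
move=> sz st kl lu lamE; rewrite dual_groth_rpp_sum ?sz // (rpp_sum_det _ _ _ sz) //.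
rewrite -hshift_det_alphabet //; last by lia.
congr (\det _); apply/matrixP => i j; rewrite !mxE mkseq_nth; congr (hshift (_ ++ _) _ _).
have iu : (i <= size u)%N by have := ltn_ord i; lia.
by rewrite -{2}(mkseq_nth 0 u) /mkseq -map_take take_iota (minn_idPl iu).
Qed.

(** * Divided differences and Lagrange interpolation of h *)

Section DividedDifference.
Variable K : fieldType.
Implicit Types (X s : seq K) (f : K -> K).

Definition ddiff X f : K :=
  \sum_(v <- X) f v / \prod_(w <- X | w != v) (v - w).

Lemma eq_ddiff X f g : f =1 g -> ddiff X f = ddiff X g.
Proof. by move=> e; apply: eq_bigr => v _; rewrite e. Qed.

Lemma perm_ddiff X Y f : perm_eq X Y -> ddiff X f = ddiff Y f.
Proof.
by move=> e; rewrite /ddiff (perm_big _ e); apply: eq_bigr => v _; rewrite (perm_big _ e).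
Qed.

Lemma ddiffD X f g : ddiff X (fun v => f v + g v) = ddiff X f + ddiff X g.
Proof. by rewrite -big_split; apply: eq_bigr => v _; rewrite mulrDl. Qed.

Lemma ddiffZ X c f : ddiff X (fun v => c * f v) = c * ddiff X f.
Proof. by rewrite /ddiff big_distrr; apply: eq_bigr => v _ /=; rewrite mulrA. Qed.

(** The factor [v - x] kills the term at [x] and cancels in every other denominator. *)
Lemma ddiff_shift x X f : x \notin X ->
  ddiff (x :: X) (fun v => (v - x) * f v) = ddiff X f.
Proof.
move=> xX; rewrite /ddiff big_cons subrr !mul0r add0r [LHS]big_seq [RHS]big_seq.
apply: eq_bigr => v vX; have xv : x != v by apply: contraNneq xX => ->.
rewrite big_cons xv invfM mulrACA divff ?mul1r //.
by rewrite subr_eq0 eq_sym.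
Qed.

Lemma ddiff_mulX x X f : x \notin X ->
  ddiff (x :: X) (fun v => v * f v) = ddiff X f + x * ddiff (x :: X) f.
Proof.
move=> xX; rewrite -(ddiff_shift f xX) -ddiffZ -ddiffD.
by apply: eq_ddiff => v; rewrite mulrBl subrK.
Qed.

(** Since [(v - x) - (v - y)] is the constant [y - x], the claim follows if dropping [x] or dropping
    [y] gives the same value: both are 1 for two nodes and 0 by induction for more. *)
Lemma ddiff_const X : uniq X -> (1 < size X)%N -> ddiff X (fun=> 1) = 0.
Proof.
have [n] := ubnP (size X); elim: n X => // n IH [|x [|y X]] //= szX.
case/andP; rewrite inE negb_or => /andP[xy xX] /andP[yX uX] _.
have Ey : ddiff [:: x, y & X] (fun v => (v - x) * 1) = ddiff (y :: X) (fun=> 1).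
  by apply: ddiff_shift; rewrite inE negb_or xy.
have Ex : ddiff [:: x, y & X] (fun v => (v - y) * 1) = ddiff (x :: X) (fun=> 1).
  rewrite (@perm_ddiff _ [:: y, x & X]); last by apply/seq.permP => p /=; lia.
  by apply: ddiff_shift; rewrite inE negb_or eq_sym xy.
have E : ddiff (y :: X) (fun=> 1) = ddiff (x :: X) (fun=> 1).
  case: X IH szX xX yX uX {Ex Ey} => [|t Y] IH szX xX yX uX.
    by rewrite /ddiff !big_cons !big_nil !eqxx.
  by rewrite !IH //= ?xX ?yX.
have : (y - x) * ddiff [:: x, y & X] (fun=> 1) = 0.
  transitivity (ddiff (y :: X) (fun=> 1) - ddiff (x :: X) (fun=> 1)); last by rewrite E subrr.
  rewrite -Ey -Ex -[- ddiff _ _]mulN1r -!ddiffZ -ddiffD.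
  by apply: eq_ddiff => v; ring.
by move/eqP; rewrite mulf_eq0 subr_eq0 eq_sym (negPf xy) => /eqP.
Qed.

Lemma ddiff_exp X d : uniq X -> (d.+1 < size X)%N -> ddiff X (fun v => v ^+ d) = 0.
Proof.
elim: d X => [|d IH] X uX dX; first exact: ddiff_const.
case: X uX dX => // x X /= /andP[xX uX] dX.
rewrite (@eq_ddiff _ _ (fun v => v * v ^+ d)); last by move=> v; rewrite exprS.
by rewrite ddiff_mulX // !IH ?mulr0 ?addr0 //= ?xX // ltnW.
Qed.

(** Splitting off the node [x] by [ddiff_mulX] reproduces the recursion [hsymS]. In the term
    multiplied by [x], the part of h free of [v] has too low a power of [v] and dies by
    [ddiff_exp]. *)
Lemma ddiff_hsym_top X s M : uniq X -> (0 < size X)%N ->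
  ddiff X (fun v => v ^+ (size X).-1 * hsym (v :: s) M) = hsym (X ++ s) M.
Proof.
elim: X M => // x [|y X] IH M uX _.
  by rewrite /ddiff !big_cons !big_nil !eqxx /= expr0 mul1r divr1 addr0.
have /andP[xX uX'] := uX; set Y := y :: X in IH xX uX' uX *.
have sY : (size (x :: Y)).-1 = (size Y).-1.+1 by [].
elim: M => [|M IHM].
  rewrite (@eq_ddiff _ _ (fun v => v * v ^+ (size Y).-1)); last first.
    by move=> v; rewrite hsym0 mulr1 sY exprS.
  rewrite ddiff_mulX // (@ddiff_exp (x :: Y)) // mulr0 addr0 hsym0 -(hsym0 (Y ++ s)) -IH //.
  by apply: eq_ddiff => v; rewrite hsym0 mulr1.
rewrite (@eq_ddiff _ _ (fun v => v * (v ^+ (size Y).-1 * hsym (v :: s) M.+1))); last first.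
  by move=> v; rewrite sY exprS mulrA.
rewrite ddiff_mulX // IH // cat_cons hsymS; congr (_ + x * _).
rewrite -[RHS]/(hsym ((x :: Y) ++ s) M) -IHM.
rewrite (@eq_ddiff _ _ (fun v => hsym s M.+1 * v ^+ (size Y).-1 +
    v ^+ (size Y) * hsym (v :: s) M)); last first.
  by move=> v; rewrite hsymS mulrDr mulrC mulrA -exprSr.
by rewrite ddiffD ddiffZ ddiff_exp // mulr0 add0r.
Qed.

(** Peeling [v] off h trades one degree for one power of [v]; the part free of [v] again dies by
    [ddiff_exp]. *)
Lemma ddiff_hsym X s M d : uniq X -> (d < size X)%N ->
  ddiff X (fun v => v ^+ ((size X).-1 - d) * hsym (v :: s) M) = hshift (X ++ s) M d.
Proof.
move=> uX; elim: d M => [|d IH] M dX.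
  by rewrite subn0 ddiff_hsym_top // /hshift subn0.
case: M => [|M].
  rewrite hshift0 -[RHS](@ddiff_exp X ((size X).-1 - d.+1)) //; last by lia.
  by apply: eq_ddiff => v; rewrite hsym0 mulr1.
have -> : hshift (X ++ s) M.+1 d.+1 = hshift (X ++ s) M d by [].
rewrite -IH ?(ltnW dX) //.
rewrite (@eq_ddiff _ _ (fun v => hsym s M.+1 * v ^+ ((size X).-1 - d.+1) +
    v ^+ ((size X).-1 - d) * hsym (v :: s) M)); last first.
  move=> v; rewrite hsymS mulrDr mulrC mulrA -exprSr; congr (_ + v ^+ _ * _); lia.
by rewrite ddiffD ddiffZ ddiff_exp ?mulr0 ?add0r //; lia.
Qed.

End DividedDifference.

(** * Summation over subsets by Cauchy-Binet *)

Section Symmetrization.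
Variables (K : fieldType) (N l : nat) (x : 'I_N -> K).
Variables (t : nat -> seq K) (L : nat -> nat).
Hypotheses (x_inj : injective x) (lN : (l <= N)%N).
Implicit Type S : {set 'I_N}.

Definition alphabet S : seq K := [seq x j | j <- enum S].

Definition hshift_mx S : 'M[K]_l :=
  \matrix_(i, j) hshift (alphabet S ++ t i) (L i) (l - j.+1).

(** [P] is common to all [S]; only [Q S] depends on the set, and its rows outside [S] are zero. *)
Let P : 'M[K]_(l, N) := \matrix_(i, v) hsym (x v :: t i) (L i).
Let Q S : 'M[K]_(N, l) := \matrix_(v, j)
  if v \in S then
    x v ^+ (#|S|.-1 - (l - j.+1)) / \prod_(w in S | w != v) (x v - x w)
  else 0.

Lemma ddiff_alphabet S f : ddiff (alphabet S) f =
  \sum_(v in S) f (x v) / \prod_(w in S | w != v) (x v - x w).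
Proof.
rewrite /ddiff /alphabet big_map big_enum; apply: eq_bigr => v _.
congr (_ / _); rewrite big_map big_enum_cond; apply: eq_bigl => w.
by rewrite (inj_eq x_inj).
Qed.

Lemma hshift_mx_fact S : (l <= #|S|)%N -> hshift_mx S = P *m Q S.
Proof.
move=> lS; apply/matrixP => i j; rewrite !mxE.
have size_S : size (alphabet S) = #|S| by rewrite size_map cardE.
rewrite -ddiff_hsym ?size_S ?map_inj_uniq ?enum_uniq //; last by have := ltn_ord j; lia.
rewrite ddiff_alphabet big_mkcond; apply: eq_bigr => v _; rewrite !mxE.
by case: ifP => _; rewrite ?mulr0 // mulrA [hsym _ _ * _]mulrC.
Qed.

Lemma det_hshift_mx_sum :
  \det (hshift_mx setT) =
  \sum_(S : {set 'I_N} | #|S| == l)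
    (\prod_(w in ~: S) \prod_(v in S) (x v / (x v - x w))) * \det (hshift_mx S).
Proof.
rewrite hshift_mx_fact ?cardsT ?card_ord // Cauchy_Binet.
apply: eq_bigr => S /eqP cardS.
rewrite hshift_mx_fact ?cardS // Cauchy_Binet (bigD1 S) ?cardS //=.
(* An image [S'] of size [l] other than [S] contains a point outside [S], which selects a zero row
   of [Q S]. *)
rewrite [X in _ * (_ + X)]big1 ?addr0 => [|S' /andP[/eqP cardS' SS']]; last first.
  apply: big1 => f /andP[_ /eqP fS'].
  have /subsetPn [v] : ~~ (S' \subset S).
    by apply: contra SS' => sub; rewrite eqEcard sub cardS cardS' leqnn.
  rewrite -fS' => /imsetP[i _ ->] fiS; rewrite (expand_det_row _ i) [X in _ * X]big1 ?mulr0 // => j _.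
  by rewrite !mxE (negPf fiS) mul0r.
rewrite big_distrr; apply: eq_bigr => f /= /andP[/injectiveP f_inj /eqP fS].
rewrite mulrCA; congr (_ * _); rewrite exchange_big /=.
have fin i : f i \in S by rewrite -fS imset_f.
rewrite -{1}fS big_imset /=; last by move=> ? ? _ _; exact: f_inj.
under eq_bigl => i do rewrite inE.
(* Row [f i] of [Q setT] is a multiple of row [f i] of [Q S]: using all nodes adds [N - l] to the
   exponent and puts the differences with [~: S] in the denominator. *)
rewrite -det_scale_rows; congr (\det _); apply/matrixP => i j; rewrite !mxE fin inE.
rewrite cardS cardsT card_ord.
have -> : \prod_(w in setT | w != f i) (x (f i) - x w) =
    \prod_(w in ~: S) (x (f i) - x w) * \prod_(w in S | w != f i) (x (f i) - x w).
  rewrite (bigID (mem S)) /= mulrC; congr (_ * _); apply: eq_bigl => w; rewrite !inE //.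
    by case: eqP => [->|]; rewrite ?fin ?andbF ?andbT.
  by rewrite andbC.
rewrite big_split /= prodfV prodr_const invfM.
have -> : #|~: S| = (N - l)%N by rewrite cardsCs setCK cardS card_ord.
rewrite mulrACA -exprD; congr (_ * _).
by congr (_ ^+ _); have := ltn_ord j; lia.
Qed.

End Symmetrization.

(** * The symmetrization identity *)

Lemma take_maxn (T : Type) (i k : nat) (s : seq T) :
  take (maxn i k) s = take k s ++ take (i - k) (drop k s).
Proof. by rewrite maxnC maxnE takeD. Qed.

(** Here [k.+1] leading parts are equal. In the summand of [S], the last [k] letters of [yS] take
    the place of the first [k] letters of [t]; in each row of the determinant they rejoin the
    others, so the alphabet is all of [yS] followed by letters of [drop k t]. *)
Lemma dual_groth_symmetrization (K : fieldType) (n l k : nat) (lam : seq nat)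
    (x t : seq K) : let y := x ++ take k t in
  is_partition lam -> size lam = l -> (k < l)%N -> (l <= n + k)%N ->
  (forall i : nat, (i <= k)%N -> nth 0%N lam i = nth 0%N lam 0) ->
  size x = n -> size t = l.-1 -> uniq y ->
  dual_groth lam x t =
  \sum_(S : {set 'I_(n + k)} | #|S| == l)
    (\prod_(i in ~: S) \prod_(j in S) (y`_j / (y`_j - y`_i))) *
    dual_groth lam (take (l - k) [seq y`_j | j : 'I_(n + k) <- enum S])
      (drop (l - k) [seq y`_j | j : 'I_(n + k) <- enum S] ++ drop k t).
Proof.
move=> y /andP[st _] sz kl lnk lamE sx sizet uy.
have sy : size y = (n + k)%N by rewrite size_cat sx size_takel // sizet; lia.
pose xi (j : 'I_(n + k)) : K := y`_j.
have xi_inj : injective xi.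
  by move=> i j /eqP; rewrite nth_uniq ?sy // => /eqP /val_inj.
pose tt i := take (i - k) (drop k t).
pose L i := (nth 0%N lam i + (l - i.+1))%N.
transitivity (\det (hshift_mx l xi tt L setT)).
  rewrite (@dual_groth_det _ l k) ?sizet //; last by lia.
  congr (\det _); apply/matrixP => i j; rewrite !mxE take_maxn catA -/y.
  have -> // : alphabet xi setT = y.
  rewrite /alphabet /xi enum_setT -enumT (map_comp (nth 0 y) val) val_enum_ord -sy.
  exact: mkseq_nth.
rewrite det_hshift_mx_sum //; apply: eq_bigr => S /eqP cardS; congr (_ * _).
set yS := [seq _ | _ <- _].
have sS : size yS = l by rewrite size_map -cardE.
have sd : size (drop (l - k) yS) = k by rewrite size_drop sS; lia.
rewrite (@dual_groth_det _ l k) //; last by rewrite size_cat sd size_drop sizet; lia.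
congr (\det _); apply/matrixP => i j; rewrite !mxE take_maxn.
by rewrite take_size_cat // drop_size_cat // catA cat_take_drop.
Qed.

Lemma tofrac_mpolyX_inj (R : idomainType) (m : nat) :
  injective (fun i : 'I_m => tofrac ('X_i : {mpoly R[m]})).
Proof.
move=> i j /eqP; rewrite tofrac_eq => /eqP /(congr1 (mcoeff U_(i)%MM)).
by rewrite !mcoeffXU eqxx; case: eqP => // _ /eqP; rewrite oner_eq0.
Qed.

Theorem theorem3p24 (R : idomainType) (n l k : nat) (lam : seq nat)
    (lam_part : is_partition lam) (lam_len : size lam = l)
    (l_le_n : (l <= n)%N) (k_bounds : (1 <= k <= l)%N)
    (lam_eq : forall i : nat, (i < k)%N -> nth 0%N lam i = nth 0%N lam 0) :
  let K : fieldType := {fraction {mpoly R[n + (l - 1)]}} in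
  let x : seq K :=
    [seq tofrac ('X_(lshift (l - 1) i) : {mpoly R[n + (l - 1)]})
    | i <- enum 'I_n] in
  let t : seq K :=
    [seq tofrac ('X_(rshift n j) : {mpoly R[n + (l - 1)]})
    | j <- enum 'I_(l - 1)] in
  let y : seq K := x ++ take (k - 1) t in
  dual_groth lam x t =
  \sum_(S : {set 'I_(n + k - 1)} | #|S| == l)
    (\prod_(i in ~: S) \prod_(j in S) (y`_j / (y`_j - y`_i))) *
    (let yS : seq K := [seq y`_j | j : 'I_(n + k - 1) <- enum S] in
     dual_groth lam (take (l - k + 1) yS)
                    (drop (l - k + 1) yS ++ drop (k - 1) t)).
Proof.
move=> K x t y.
(* From here on [k] stands for the former [k - 1]. *)
case: k k_bounds lam_eq @y => [//|k] kl lam_eq y; rewrite {}/y subSS subn0.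
have -> : (n + k.+1 - 1)%N = (n + k)%N by rewrite addnS subn1.
have -> : (l - k.+1 + 1)%N = (l - k)%N by lia.
apply: dual_groth_symmetrization => //; rewrite ?size_map -?enumT ?size_enum_ord ?subn1 //; first by lia.
(* [y] is a prefix of the list of all the indeterminates, hence duplicate free. *)
have -> : x ++ take k t = take (n + k) (x ++ t).
  by rewrite take_cat size_map size_enum_ord ltnNge leq_addr addKn.
apply: take_uniq; rewrite cat_uniq !map_inj_uniq -?enumT ?enum_uniq ?andbT // ?andTb.
- apply/hasPn => v /mapP[j _ ->]; apply/negP => /mapP[i _ /tofrac_mpolyX_inj].
  by move/eqP; rewrite eq_rlshift.
- by move=> i j /tofrac_mpolyX_inj /rshift_inj.
- by move=> i j /tofrac_mpolyX_inj /lshift_inj.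
Qed.
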